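(* Let $p,q,n$ be positive integers, let $\mu\in\mathbb{R}^{pq}$, let $\Gamma\in\mathcal{M}_{p,p}(\mathbb{R})$ be a diagonal matrix with strictly positive diagonal entries, and let $\Psi\in\mathcal{M}_{q,q}(\mathbb{R})$ be symmetric positive definite ($\mu,\Gamma,\Psi$ unknown). Let $X_1,\ldots,X_n$ be independent random matrices in $\mathcal{M}_{p,q}(\mathbb{R})$ with $\mathrm{vec}(X_k)\sim\mathcal{N}(\mu,\Psi\otimes\Gamma)$ for $k=1,\ldots,n$. If $n>q$, then the maximum likelihood estimator of $\Psi\otimes\Gamma$ (in the model in which $\Gamma$ is constrained to be diagonal and $\Psi$ is only constrained to be positive definite) exists with probability $1$.
   Context: $\mathcal{M}_{p,q}(\mathbb{R})$ is the set of real $p\times q$ matrices, $\mathrm{vec}$ stacks the columns of a matrix into one vector, and $\otimes$ is the Kronecker product. The likelihood function, for $M\in\mathcal{M}_{p,q}(\mathbb{R})$ (with $\mathrm{vec}(M)$ the mean vector) and positive definite $\Gamma\in\mathcal{M}_{p,p}(\mathbb{R})$, $\Psi\in\mathcal{M}_{q,q}(\mathbb{R})$, is $$L(M,\Gamma,\Psi)=(2\pi)^{-\frac12 pqn}|\Gamma|^{-\frac12 qn}|\Psi|^{-\frac12 pn}\exp\Big(-\tfrac12\,\mathrm{trace}\Big(\Psi^{-1}\sum_{k=1}^n (X_k-M)^T\Gamma^{-1}(X_k-M)\Big)\Big),$$ where $|A|$ is the determinant of $A$. It depends on $(\Gamma,\Psi)$ only through $\Psi\otimes\Gamma$. In the model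 with $\Gamma$ diagonal, a maximum likelihood estimator of $\Psi\otimes\Gamma$ is a matrix $\hat\Psi\otimes\hat\Gamma$, with $\hat\Gamma$ diagonal with strictly positive diagonal entries and $\hat\Psi$ symmetric positive definite, such that $L$ attains its maximum over all $M\in\mathcal{M}_{p,q}(\mathbb{R})$, all diagonal $\Gamma$ with strictly positive diagonal entries and all symmetric positive definite $\Psi$ at $(\hat M,\hat\Gamma,\hat\Psi)$, where $\hat M=\frac1n\sum_{k=1}^n X_k$. The estimator exists if at least one such matrix exists. *)

(* Defs.v *)
(* MathComp / MathComp-Analysis *)
From HB Require Import structures.
From mathcomp Require Import all_boot all_order all_algebra.
From mathcomp Require Import all_classical all_reals all_analysis.
From mathcomp.real_closed Require Import mxtens.

Set Implicit Arguments.
Unset Strict Implicit.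
Unset Printing Implicit Defensive.

Import Order.TTheory GRing.Theory Num.Theory.
Import numFieldNormedType.Exports.

Local Open Scope classical_set_scope.
Local Open Scope ring_scope.

Definition symmetric_posdef (R : realType) (m : nat) (A : 'M[R]_m) : Prop :=
  A^T = A /\ forall x : 'cV[R]_m, x != 0 -> 0 < (x^T *m A *m x) 0 0.

Definition diagonal_pos (R : realType) (m : nat) (A : 'M[R]_m) : Prop :=
  is_diag_mx A /\ forall i, 0 < A i i.

(* Column stacking. The index of entry (i, j) is [mxtens_index (j, i)], of value
   j * p + i, which is the indexing used by the Kronecker product
   [Psi *t Gamma] for Psi : 'M_q and Gamma : 'M_p. ([mxvec] stacks the rows.) *)
Definition vec (R : realType) (p q : nat) (A : 'M[R]_(p, q)) : 'cV[R]_(q * p) :=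
  \col_k A (mxtens_unindex k).2 (mxtens_unindex k).1.

(* Matrices with their Borel sigma-algebra. *)
Definition borel_matrix (R : realType) (p q : nat) :=
  g_sigma_algebraType (@open 'M[R]_(p, q)).

HB.instance Definition _ (R : realType) (p q : nat) :=
  Measurable.on (borel_matrix R p q).

Definition mutually_independent (R : realType) (d d' : measure_display)
    (T : measurableType d) (T' : measurableType d') (P : probability T R)
    (I : finType) (X : I -> {RV P >-> T'}) : Prop :=
  forall (J : {set I}) (B : I -> set T'), (forall k, measurable (B k)) ->
    P (\bigcap_(k in [set k | k \in J]) (X k @^-1` B k)) =
    (\prod_(k in J) P (X k @^-1` B k))%E.

(* N(m, v) on the line, v >= 0 being the variance ([normal_prob] takes a
   standard deviation, and is not the point mass when it is 0). *)
Definition normal_law (R : realType) (m v : R) : set R -> \bar R :=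
  if v == 0 then \d_m else normal_prob m (Num.sqrt v).

(* Y ~ N(mu, Sigma): every linear form a^T Y has the normal distribution with
   mean a^T mu and variance a^T Sigma a (with a = 0 giving the point mass
   at 0). *)
Definition multivariate_normal (R : realType) (d : measure_display)
    (T : measurableType d) (P : probability T R) (N : nat)
    (Y : T -> 'cV[R]_N) (mu : 'cV[R]_N) (Sigma : 'M[R]_N) : Prop :=
  forall (a : 'cV[R]_N) (B : set R), measurable B ->
    P [set w | B ((a^T *m Y w) 0 0)] =
    normal_law ((a^T *m mu) 0 0) ((a^T *m Sigma *m a) 0 0) B.

Definition likelihood (R : realType) (p q n : nat) (x : 'I_n -> 'M[R]_(p, q))
    (M : 'M[R]_(p, q)) (Gamma : 'M[R]_p) (Psi : 'M[R]_q) : R :=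
  (2 * pi) `^ (- (2^-1 * (p * q * n)%:R))
  * (\det Gamma) `^ (- (2^-1 * (q * n)%:R))
  * (\det Psi) `^ (- (2^-1 * (p * n)%:R))
  * expR (- (2^-1 * \tr (invmx Psi *m
      \sum_(k < n) ((x k - M)^T *m invmx Gamma *m (x k - M))))).

Definition sample_mean (R : realType) (p q n : nat)
    (x : 'I_n -> 'M[R]_(p, q)) : 'M[R]_(p, q) :=
  n%:R^-1 *: \sum_(k < n) x k.

Definition is_mle_diag (R : realType) (p q n : nat) (x : 'I_n -> 'M[R]_(p, q))
    (S : 'M[R]_(q * p)) : Prop :=
  exists (Gamma0 : 'M[R]_p) (Psi0 : 'M[R]_q),
    [/\ diagonal_pos Gamma0, symmetric_posdef Psi0, S = Psi0 *t Gamma0 &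
      forall (M : 'M[R]_(p, q)) (Gamma : 'M[R]_p) (Psi : 'M[R]_q),
        diagonal_pos Gamma -> symmetric_posdef Psi ->
        likelihood x M Gamma Psi
        <= likelihood x (sample_mean x) Gamma0 Psi0].

(* Main.v *)
(* Write Psi^-1 = B^T B (Cholesky). For fixed B the likelihood is maximal at the
   sample mean and at gamma_i = t_i(B) / (q n), where t_i(B) = tr (B S_i B^T) and
   S_i is the scatter matrix of the i-th rows of the centred observations; this
   is the inequality u exp(-u) <= exp(-1). The maximal value is an increasing
   function of det(B)^(2p) / prod_i t_i(B)^q, which is homogeneous of degree 0
   in B and, when every S_i is nonsingular, continuous on the unit sphere: it
   attains its maximum there, at an invertible B since it vanishes when
   det B = 0.

   Every S_i is nonsingular as soon as the vectors (1, x_ki), k <= q, where x_ki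
   is the i-th row of X_k, form an invertible matrix. Its leading minors are
   almost surely nonzero, by induction: expanding the next one along its last
   row gives an affine form in a new observation, independent of the
   coefficients, whose linear part is nonzero by induction; and a nondegenerate
   Gaussian does not charge hyperplanes. *)
Require Import Defs.
From HB Require Import structures.
From mathcomp Require Import all_boot all_order all_algebra.
From mathcomp Require Import all_classical all_reals all_analysis.
From mathcomp.real_closed Require Import mxtens.
From mathcomp Require Import measurable_realfun ring lra.

Set Implicit Arguments.
Unset Strict Implicit.
Unset Printing Implicit Defensive.

Import Order.TTheory GRing.Theory Num.Theory.
Import numFieldNormedType.Exports.

Local Open Scope classical_set_scope.
Local Open Scope ring_scope.

(** * Positive definite matrices and their factorisations *)

Lemma unitmx_neq0 (R : fieldType) n (A : 'M[R]_n) :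
  (0 < n)%N -> A \in unitmx -> A != 0.
Proof.
move=> n_gt0; apply: contraTneq => ->; rewrite unitmxE -(scale0r 1%:M) detZ expr0n.
by rewrite gtn_eqF// mul0r unitr0.
Qed.

Lemma posdef_gram (R : realType) n (C : 'M[R]_n) :
  C \in unitmx -> symmetric_posdef (C^T *m C).
Proof.
move=> uC; split; first by rewrite trmx_mul trmxK.
move=> x x0.
have -> : x^T *m (C^T *m C) *m x = (C *m x)^T *m (C *m x).
  by rewrite trmx_mul !mulmxA.
have Cx0 : C *m x != 0.
  by apply: contraNneq x0 => /(congr1 (mulmx (invmx C))); rewrite mulKmx// mulmx0 => ->.
rewrite mxE; under eq_bigr do rewrite mxE -expr2.
rewrite lt_def sumr_ge0 ?andbT => [|i _]; last exact: sqr_ge0.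
apply: contraNneq Cx0 => /eqP; rewrite psumr_eq0 => [/allP h|i _]; last exact: sqr_ge0.
apply/eqP/matrixP => i j; rewrite ord1 [RHS]mxE.
by have := h i (mem_index_enum _); rewrite sqrf_eq0 => /eqP.
Qed.

(** Induction on the size: the Schur complement [D] of the top left entry is again positive
    definite, and its factor is bordered by a first row. *)
Lemma posdef_cholesky (R : realType) n (A : 'M[R]_n) :
  symmetric_posdef A -> exists2 C, C \in unitmx & A = C^T *m C.
Proof.
elim: n A => [|n IHn] A [Asym Apos].
  by exists 1%:M; [exact: unitmx1|apply/matrixP => -[]].
rewrite -[n.+1]/(1 + n)%N in A Asym Apos *.
pose a := A 0 0.
have a0 : 0 < a.
  have /Apos : (delta_mx 0 0 : 'cV[R]_(1 + n)) != 0.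
    by apply/eqP => /matrixP/(_ 0 0)/eqP; rewrite !mxE !eqxx oner_eq0.
  by rewrite trmx_delta -rowE -colE !mxE.
pose b := dlsubmx A.
have AE : A = block_mx a%:M b^T b (drsubmx A).
  rewrite -[LHS]submxK; congr block_mx.
    apply/matrixP => i j; rewrite !ord1 !mxE eqxx mulr1n.
    by congr (A _ _); apply: val_inj.
  by rewrite /b trmx_dlsub Asym.
have Dsym : (drsubmx A)^T = drsubmx A by rewrite trmx_drsub Asym.
pose D := drsubmx A - a^-1 *: (b *m b^T).
have /IHn[C uC DE] : symmetric_posdef D.
  split; first by rewrite linearB linearZ /= trmx_mul trmxK Dsym.
  move=> x x0.
  (* The first coordinate cancels the first entry of [A *m y], so that the form of [A] at [y] equals
     the form of [D] at [x]. *)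
  pose y : 'cV[R]_(1 + n) := col_mx (- a^-1 *: (b^T *m x)) x.
  have /Apos : y != 0.
    apply: contraNneq x0 => y0.
    by rewrite -[x](col_mxKd (- a^-1 *: (b^T *m x))) -/y y0 linear0.
  congr (0 < _ 0 0).
  rewrite AE /y tr_col_mx -mulmxA mul_block_col mul_row_col.
  rewrite mul_scalar_mx scalerA mulrN divff ?gt_eqF// scaleN1r addNr mulmx0 add0r.
  by rewrite -scalemxAr scaleNr -mulmxA mulmxDl mulNmx -scalemxAl addrC mulmxA.
pose s := Num.sqrt a.
have s0 : s != 0 by rewrite gt_eqF// sqrtr_gt0.
have ss : s * s = a by rewrite -expr2 sqr_sqrtr// ltW.
exists (block_mx s%:M (s^-1 *: b^T) 0 C).
  rewrite unitmxE (det_ublock s%:M) det_scalar1 unitrM -unitmxE uC andbT unitfE//.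
rewrite [LHS]AE tr_block_mx mulmx_block !tr_scalar_mx trmx0 !mul0mx !mulmx0 !addr0.
rewrite mul_scalar_mx scale_scalar_mx ss mul_scalar_mx scalerA divff// scale1r.
rewrite linearZ /= trmxK -scalemxAl mul_mx_scalar scalerA mulVf// scale1r.
by rewrite -scalemxAl -scalemxAr scalerA -invfM ss -DE addrC subrK.
Qed.

(** The likelihood sees [Psi] only through its inverse and determinant, so [B], the inverse
    transpose of a Cholesky factor, can serve as parameter. *)
Lemma posdef_invmx (R : realType) n (A : 'M[R]_n) :
  symmetric_posdef A -> exists B,
    [/\ B \in unitmx, invmx A = B^T *m B & \det A = (\det B) ^- 2].
Proof.
move=> /posdef_cholesky[C uC AE]; exists (invmx C^T).
have uCT : C^T \in unitmx by rewrite unitmx_tr.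
split.
- by rewrite unitmx_inv.
- rewrite AE trmx_inv trmxK.
  have h : C^T *m C \in unitmx by rewrite unitmx_mul uCT.
  apply: (can_inj (mulmxK h)); rewrite mulVmx// -mulmxA (mulmxA (invmx C^T)).
  by rewrite mulVmx// mul1mx mulVmx.
- by rewrite AE det_mulmx det_inv det_tr exprVn invrK expr2.
Qed.

(** * Two scalar inequalities *)

Lemma expR_scale_max (R : realType) (N : nat) (t g : R) :
  (0 < N)%N -> 0 < t -> 0 < g ->
  g ^- N * expR (- (t / g)) <= (t / N%:R) ^- N * expR (- N%:R).
Proof.
move=> N0 t0 g0; have N0' : 0 < N%:R :> R by rewrite ltr0n.
(* In terms of [u] the claim is the N-th power of u exp(-u) <= exp(-1), with equality at g = t /
   N. *)
pose u := t / (N%:R * g).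
have u0 : 0 < u by rewrite divr_gt0// mulr_gt0.
have -> : - (t / g) = N%:R * (- u) by rewrite /u; field; lra.
have -> : - N%:R = N%:R * (- 1) :> R by rewrite mulrN1.
have -> : (t / N%:R) ^- N = g ^- N * u ^- N.
  by rewrite -invfM -exprMn; congr ((_ ^+ _)^-1); rewrite /u; field; lra.
rewrite -mulrA ler_pM2l ?invr_gt0 ?exprn_gt0// !expRM_natl.
rewrite [leRHS]mulrC ler_pdivlMr ?exprn_gt0// mulrC -exprMn.
have u0' := ltW u0.
rewrite ler_pXn2r ?nnegrE ?expR_ge0//; last by rewrite mulr_ge0// expR_ge0.
rewrite [expR (- u)]expRN ler_pdivrMr ?expR_gt0// -expRD.
 by have := expR_ge1Dx (-1 + u); lra. 
Qed.

(** Expanding around the mean, the cross term vanishes since the deviations sum to zero. *)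
Lemma sum_sqr_mean_le (R : realFieldType) n (a : 'I_n -> R) (m : R) :
  \sum_k (a k - n%:R^-1 * \sum_l a l) ^+ 2 <= \sum_k (a k - m) ^+ 2.
Proof.
case: n a => [|n] a; first by rewrite !big_ord0.
set b := _ * _.
have -> : \sum_k (a k - m) ^+ 2 =
    \sum_k ((a k - b) ^+ 2 + 2 * (b - m) * (a k - b) + (b - m) ^+ 2).
  by apply: eq_bigr => k _; ring.
rewrite !big_split /= -mulr_sumr (_ : \sum_k (a k - b) = 0).
  by rewrite mulr0 addr0 lerDl sumr_ge0// => *; exact: sqr_ge0.
rewrite big_split /= sumr_const card_ord -[_ *+ _]mulr_natl mulrN.
by rewrite /b mulrA divff ?pnatr_eq0// mul1r subrr.
Qed.

(** * Continuity of polynomial functions of matrix entries *)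

Lemma continuous_sum (R : realType) (T : topologicalType) I (r : seq I)
    (P : pred I) (F : I -> T -> R) :
  (forall i, P i -> continuous (F i)) ->
  continuous (fun x => \sum_(i <- r | P i) F i x).
Proof. by apply: continuous_big; exact: (@add_continuous R). Qed.

Lemma continuous_prod (R : realType) (T : topologicalType) I (r : seq I)
    (P : pred I) (F : I -> T -> R) :
  (forall i, P i -> continuous (F i)) ->
  continuous (fun x => \prod_(i <- r | P i) F i x).
Proof. by apply: continuous_big; exact: (@mul_continuous R). Qed.

Lemma continuous_exp (R : realType) (T : topologicalType) (f : T -> R) m :
  continuous f -> continuous (fun x => f x ^+ m).
Proof.
move=> cf x; elim: m => [|m IHm]; first exact: cvg_cst.
by under eq_fun do rewrite exprS; apply: cvgM; [exact: cf|exact: IHm].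
Qed.

Lemma continuous_det (R : realType) (T : topologicalType) n (A : T -> 'M[R]_n) :
  (forall i j, continuous (fun x => A x i j)) -> continuous (fun x => \det (A x)).
Proof.
move=> cA; apply: continuous_sum => s _ x.
by apply: cvgM; [exact: cvg_cst|apply: continuous_prod => i _; exact: cA].
Qed.

(** * The profile function and its maximum *)

Section row_scatter.
Variables (R : realType) (p q n : nat) (y : 'I_n -> 'M[R]_(p, q)).

(* tr (B^T B S_i), S_i being the scatter matrix of the i-th rows of the y k. *)
Definition row_scatter (B : 'M[R]_q) (i : 'I_p) : R :=
  \sum_k \sum_j (y k *m B^T) i j ^+ 2.

(** Nonsingularity of every S_i, since v^T S_i v is the sum over k of the squares of
    [row i (y k) *m v]. *)
Definition rows_span :=
  forall (i : 'I_p) (v : 'cV[R]_q), (forall k, row i (y k) *m v = 0) -> v = 0.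

(* Up to a constant factor and the exponent n, the square of the likelihood
   maximised over the mean and over the row variances, at Psi^-1 = B^T B. *)
Definition profile (B : 'M[R]_q) : R :=
  (\det B ^+ 2) ^+ p / \prod_i row_scatter B i ^+ q.

Lemma row_scatterZ c B i : row_scatter (c *: B) i = c ^+ 2 * row_scatter B i.
Proof.
rewrite /row_scatter mulr_sumr; apply: eq_bigr => k _.
rewrite mulr_sumr; apply: eq_bigr => j _.
by rewrite linearZ -scalemxAr mxE exprMn.
Qed.

(** Numerator and denominator are both homogeneous of degree 2pq in [B]. *)
Lemma profileZ c B : c != 0 -> profile (c *: B) = profile B.
Proof.
move=> c0; rewrite /profile detZ !exprMn -!exprM.
under eq_bigr do rewrite row_scatterZ exprMn.
rewrite big_split /= prodr_const card_ord -!exprM mul2n -addnn exprD.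
by rewrite mulrACA -mulf_div divff ?mul1r// mulf_neq0// expf_neq0.
Qed.

Hypothesis yspan : rows_span.

(** If the sum of squares vanishes, each column of [B^T] is annihilated by the i-th rows of all
    [y k], hence is zero. *)
Lemma row_scatter_gt0 B i : B != 0 -> 0 < row_scatter B i.
Proof.
move=> B0; rewrite lt_def; apply/andP; split; last first.
  by apply: sumr_ge0 => k _; apply: sumr_ge0 => j _; exact: sqr_ge0.
apply: contraNneq B0 => /eqP; rewrite psumr_eq0; last first.
  by move=> k _; apply: sumr_ge0 => j _; exact: sqr_ge0.
move=> /allP h; have yB0 k j : (y k *m B^T) i j = 0.
  have := h k (mem_index_enum _); rewrite psumr_eq0 => [/allP/(_ j)|? _].
    by rewrite mem_index_enum sqrf_eq0 => /(_ isT)/eqP.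
  exact: sqr_ge0.
have colB0 j : col j B^T = 0.
  apply: (yspan (i := i)) => k; apply/matrixP => ? ?; rewrite !ord1 [RHS]mxE.
  by rewrite -(yB0 k j) !mxE; apply: eq_bigr => l _; rewrite !mxE.
apply/eqP/matrixP => j a; have /matrixP/(_ a 0) := colB0 j.
by rewrite !mxE.
Qed.

Lemma profile_max : (0 < p)%N -> (0 < q)%N ->
  exists2 B0, B0 \in unitmx & forall B, B \in unitmx -> profile B <= profile B0.
Proof.
move=> p0 q0.
have unit0 (B : 'M[R]_q) : B \in unitmx -> B != 0 := unitmx_neq0 q0.
(* Matrices are flattened to row vectors, so that compactness and the extreme value theorem apply on
   the unit sphere. *)
pose S := [set b : 'rV[R]_(q * q) | `|b| = 1].
have normalize (B : 'M[R]_q) : B != 0 ->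
    exists2 c, c != 0 & S (mxvec (c *: B)).
  move=> B0; have b0 : `|mxvec B| != 0 by rewrite normr_eq0 mxvec_eq0.
  exists `|mxvec B|^-1; first by rewrite invr_eq0.
  by rewrite /S/= linearZ normrZ normfV normr_id mulVf.
have cS : compact S.
  apply: bounded_closed_compact.
    by exists 1; split => // e e1 b /= ->; exact: ltW.
  rewrite (_ : S = (fun b : 'rV[R]_(q * q) => `|b|) @^-1` [set 1])//.
  by apply: closed_comp => [b _|]; [exact: norm_continuous|exact: closed_eq].
have S0 (b : 'rV[R]_(q * q)) : S b -> vec_mx b != 0.
  by rewrite /S/= => b1; rewrite vec_mx_eq0 -normr_eq0 b1 oner_eq0.
have cvecmx i j : continuous (fun b : 'rV[R]_(q * q) => vec_mx b i j).
  by under eq_fun do rewrite mxE; exact: coord_continuous.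
have cvecmxT i j : continuous (fun b : 'rV[R]_(q * q) => (vec_mx b)^T i j).
  by under eq_fun do rewrite mxE; exact: cvecmx.
have u1 : 1%:M \in unitmx := unitmx1 R q.
have [c0 c00 Sc0] := normalize _ (unit0 _ u1).
have S_nonempty : S !=set0 by exists (mxvec (c0 *: 1%:M)).
have cnum : continuous (fun b : 'rV[R]_(q * q) => (\det (vec_mx b) ^+ 2) ^+ p).
  by do 2 apply: continuous_exp; exact: continuous_det.
have cden : continuous
    (fun b : 'rV[R]_(q * q) => \prod_i row_scatter (vec_mx b) i ^+ q : R).
  apply: continuous_prod => i _; apply: continuous_exp.
  apply: continuous_sum => k _; apply: continuous_sum => j _.
  apply: continuous_exp; under eq_fun do rewrite mxE.
  apply: continuous_sum => l _ z; apply: continuousM; first exact: cst_continuous.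
  exact: cvecmxT.
have [|b0 /set_mem Sb0 b0max] := EVT_max_rV (f := profile \o vec_mx) S_nonempty cS.
  apply: continuous_in_subspaceT => b /set_mem Sb.
  apply: (cvgM (cnum b)); apply: (fun h => cvgV h (cden b)).
  by apply/prodf_neq0 => i _; rewrite expf_neq0// gt_eqF// row_scatter_gt0// S0.
have max (B : 'M[R]_q) : B \in unitmx -> profile B <= profile (vec_mx b0).
  move=> uB; have [c cn0 ScB] := normalize _ (unit0 _ uB).
  have := b0max _ (mem_set ScB).
  by rewrite /= mxvecK profileZ.
exists (vec_mx b0) => //.
(* The maximum is at least the positive value at the identity, whereas a singular matrix has profile
   0 because p > 0. *)
have : 0 < profile (vec_mx b0).
  apply: lt_le_trans (max _ u1); rewrite /profile det1 !expr1n mul1r invr_gt0.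
  by apply: prodr_gt0 => i _; rewrite exprn_gt0// row_scatter_gt0// unit0.
rewrite unitmxE unitfE; apply: contraTneq; rewrite /profile => ->.
by rewrite expr0n /= expr0n gtn_eqF// mul0r ltxx.
Qed.

End row_scatter.

(** * Powers, determinants and traces in the likelihood *)

Lemma powR_half_sqr (R : realType) (x : R) m :
  0 <= x -> (x `^ (- (2^-1 * m%:R))) ^+ 2 = x ^- m.
Proof.
move=> x0; rewrite -powR_mulrn ?powR_ge0// -powRrM mulNr.
by rewrite mulrAC mulVf ?pnatr_eq0// mul1r powRN powR_mulrn.
Qed.

Lemma diagonal_posP (R : realType) m (A : 'M[R]_m) : diagonal_pos A ->
  [/\ A = diag_mx (\row_i A i i), \det A = \prod_i A i i
     & invmx A = diag_mx (\row_i (A i i)^-1)].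
Proof.
move=> [/is_diag_mxP Ad Apos].
have AE : A = diag_mx (\row_i A i i).
  apply/matrixP => i j; rewrite !mxE; have [->|ij] := eqVneq i j.
    by rewrite mulr1n.
  by rewrite Ad.
have detA : \det A = \prod_i A i i.
  by rewrite {1}AE det_diag; apply: eq_bigr => i _; rewrite mxE.
split => //.
have uA : A \in unitmx.
  by rewrite unitmxE unitfE detA; apply/prodf_neq0 => i _; rewrite gt_eqF.
apply: (can_inj (mulKmx uA)); rewrite mulmxV// {1}AE.
apply/matrixP => i j; rewrite mul_diag_mx !mxE.
have [->|ij] := eqVneq i j; last by rewrite !mulr0n mulr0.
by rewrite !mulr1n divff// gt_eqF.
Qed.

(** By cyclicity the trace pairs [y k *m B^T] with itself through the inverse of [Gamma], which is
    diagonal and so only weights the rows. *)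
Lemma mxtrace_scatter (R : realType) p q n (y : 'I_n -> 'M[R]_(p, q))
    (Gamma : 'M[R]_p) (B : 'M[R]_q) : diagonal_pos Gamma ->
  \tr (B^T *m B *m \sum_k ((y k)^T *m invmx Gamma *m y k)) =
  \sum_i row_scatter y B i / Gamma i i.
Proof.
move=> /diagonal_posP[_ _ ->].
under [RHS]eq_bigr do rewrite /row_scatter mulr_suml.
rewrite [RHS]exchange_big /= mulmx_sumr raddf_sum; apply: eq_bigr => k _ /=.
have -> : B^T *m B *m ((y k)^T *m diag_mx (\row_i (Gamma i i)^-1) *m y k) =
    B^T *m ((y k *m B^T)^T *m (diag_mx (\row_i (Gamma i i)^-1) *m y k)).
  by rewrite trmx_mul trmxK !mulmxA.
rewrite mxtrace_mulC -2!mulmxA.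
rewrite /mxtrace; under [LHS]eq_bigr do rewrite mxE.
rewrite [LHS]exchange_big; apply: eq_bigr => i _; rewrite mulr_suml.
by apply: eq_bigr => j _; rewrite mul_diag_mx !mxE expr2 mulrCA mulrC.
Qed.

(** * Maximisation of the likelihood *)

Section mle.
Variables (R : realType) (p q n : nat) (x : 'I_n -> 'M[R]_(p, q)).
Hypotheses (p_gt0 : (0 < p)%N) (q_gt0 : (0 < q)%N) (n_gt0 : (0 < n)%N).

Let y k := x k - sample_mean x.

Lemma row_scatter_mean_le (M : 'M[R]_(p, q)) (B : 'M[R]_q) i :
  row_scatter y B i <= row_scatter (fun k => x k - M) B i.
Proof.
rewrite /row_scatter exchange_big [leRHS]exchange_big; apply: ler_sum => j _.
have entryB (A M' : 'M[R]_(p, q)) : ((A - M') *m B^T) i j = (A *m B^T) i j - (M' *m B^T) i j.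
  by rewrite mulmxBl !mxE.
have meanE : (sample_mean x *m B^T) i j = n%:R^-1 * \sum_l (x l *m B^T) i j.
  by rewrite -scalemxAl mulmx_suml mxE summxE.
under eq_bigr do rewrite entryB meanE.
by under [leRHS]eq_bigr do rewrite entryB; exact: sum_sqr_mean_le.
Qed.

(** Squaring turns the half-integer exponents into integers; the determinant of [Gamma] and the
    exponential then split over the rows. *)
Lemma sqr_likelihood (M : 'M[R]_(p, q)) (Gamma : 'M[R]_p) (Psi B : 'M[R]_q) :
    diagonal_pos Gamma -> B \in unitmx -> invmx Psi = B^T *m B ->
    \det Psi = (\det B) ^- 2 ->
  likelihood x M Gamma Psi ^+ 2 =
  ((2 * pi) ^- (p * q * n) * (\det B ^+ 2) ^+ (p * n)) *
  \prod_i (Gamma i i ^- (q * n) *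
           expR (- (row_scatter (fun k => x k - M) B i / Gamma i i))).
Proof.
move=> dG uB PsiE detPsi; rewrite /likelihood PsiE mxtrace_scatter//.
have [_ detG _] := diagonal_posP dG.
have detPsi_ge0 : 0 <= \det Psi by rewrite detPsi invr_ge0 sqr_ge0.
have detG_ge0 : 0 <= \det Gamma.
  by rewrite detG prodr_ge0// => i _; apply: ltW; case: dG.
have expMn4 (a b c e : R) : (a * b * c * e) ^+ 2 = a ^+ 2 * b ^+ 2 * c ^+ 2 * e ^+ 2.
  by ring.
rewrite expMn4 !powR_half_sqr ?mulr_ge0 ?pi_ge0//.
rewrite {1}detPsi exprVn invrK big_split /= prodfV prodrXl -detG.
rewrite -expR_sum sumrN -expRM_natl mulrN mulrA divff ?pnatr_eq0// mul1r.
by rewrite mulrA; congr (_ * _); rewrite mulrAC.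
Qed.

Let N := (q * n)%N.

(** Squared likelihood at the sample mean and at the row variances t_i(B) / N optimal for [B]; up to
    a positive constant it is the n-th power of [profile y B]. *)
Let profile_likelihood (B : 'M[R]_q) : R :=
  ((2 * pi) ^- (p * q * n) * (\det B ^+ 2) ^+ (p * n)) *
  \prod_i ((row_scatter y B i / N%:R) ^- N * expR (- N%:R)).

Let profile_likelihoodE B :
  profile_likelihood B =
  (2 * pi) ^- (p * q * n) * (N%:R ^+ N * expR (- N%:R)) ^+ p * profile y B ^+ n.
Proof.
have E i : (row_scatter y B i / N%:R) ^- N * expR (- N%:R) =
    (N%:R ^+ N * expR (- N%:R)) * (row_scatter y B i ^+ q) ^- n.
  by rewrite expr_div_n invf_div -exprM mulrAC.
rewrite /profile_likelihood; under eq_bigr do rewrite E.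
rewrite big_split /= prodr_const card_ord prodfV prodrXl.
rewrite [profile y B ^+ n]exprMn exprVn -[((\det B ^+ 2) ^+ p) ^+ n]exprM.
by rewrite mulrACA.
Qed.

Lemma mle_diag_exists : rows_span y -> exists S, is_mle_diag x S.
Proof.
move=> yspan.
have [B0 uB0 B0max] := profile_max yspan p_gt0 q_gt0.
have N_gt0 : (0 < N)%N by rewrite muln_gt0 q_gt0.
have NR_gt0 : 0 < N%:R :> R by rewrite ltr0n.
have unit_neq0 (B : 'M[R]_q) : B \in unitmx -> B != 0 := unitmx_neq0 q_gt0.
pose Gamma0 : 'M[R]_p := diag_mx (\row_i (row_scatter y B0 i / N%:R)).
have Gamma0E i : Gamma0 i i = row_scatter y B0 i / N%:R.
  by rewrite !mxE eqxx mulr1n.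
have dG0 : diagonal_pos Gamma0.
  split; first exact: diag_mx_is_diag.
  by move=> i; rewrite Gamma0E divr_gt0// row_scatter_gt0// unit_neq0.
(* Chosen so that the inverse of [D^T *m D] is [B0^T *m B0]. *)
pose D := invmx B0^T.
have uD : D \in unitmx by rewrite unitmx_inv unitmx_tr.
pose Psi0 := D^T *m D.
have Psi0E : invmx Psi0 = B0^T *m B0.
  have uPsi0 : Psi0 \in unitmx by rewrite unitmx_mul unitmx_tr uD.
  apply: (can_inj (mulmxK uPsi0)); rewrite mulVmx// /Psi0 /D trmx_inv trmxK.
  by rewrite -mulmxA mulKVmx// mulmxV// unitmx_tr.
have detPsi0 : \det Psi0 = (\det B0) ^- 2.
  by rewrite det_mulmx det_tr det_inv det_tr -invfM expr2.
exists (Psi0 *t Gamma0), Gamma0, Psi0; split => //; first exact: posdef_gram.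
move=> M Gamma Psi dG /posdef_invmx[B [uB PsiE detPsi]].
have lik_ge0 M' (Gamma' : 'M[R]_p) Psi' : 0 <= likelihood x M' Gamma' Psi'.
  by rewrite /likelihood !mulr_ge0 ?powR_ge0 ?expR_ge0.
rewrite -(@ler_pXn2r _ 2)// ?nnegrE// (sqr_likelihood _ dG uB PsiE)//.
rewrite (sqr_likelihood _ dG0 uB0 Psi0E)//.
have pi2_gt0 : 0 < (2 * pi : R) by rewrite mulr_gt0 ?pi_gt0.
have det_ge0 (B' : 'M[R]_q) m : 0 <= (\det B' ^+ 2) ^+ m.
  by apply: exprn_ge0; exact: sqr_ge0.
have const_ge0 (B' : 'M[R]_q) m k : 0 <= (2 * pi) ^- m * (\det B' ^+ 2) ^+ k.
  by rewrite mulr_ge0 ?invr_ge0 ?det_ge0// exprn_ge0// ltW.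
have profile_ge0 B' : 0 <= profile y B'.
  rewrite /profile divr_ge0 ?det_ge0//; apply: prodr_ge0 => i _.
  apply: exprn_ge0; apply: sumr_ge0 => k _; apply: sumr_ge0 => j _.
  exact: sqr_ge0.
(* At fixed [B], pass to the sample mean and to the optimal row variances. *)
apply: (@le_trans _ _ (profile_likelihood B)).
  rewrite ler_wpM2l//.
  apply: ler_prod => i _; have Gi0 : 0 < Gamma i i by case: dG.
  have ti0 := row_scatter_gt0 yspan i (unit_neq0 _ uB).
  rewrite mulr_ge0 ?invr_ge0 ?exprn_ge0 ?expR_ge0 ?(ltW Gi0)//=.
  apply: le_trans (expR_scale_max N_gt0 ti0 Gi0).
  rewrite ler_wpM2l ?invr_ge0 ?exprn_ge0 ?(ltW Gi0)// ler_expR lerN2.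
  by rewrite ler_wpM2r ?invr_ge0 ?(ltW Gi0)// row_scatter_mean_le.
(* [Gamma0] attains the bound at [B0]; it remains to compare the profiles of [B] and [B0]. *)
apply: (@le_trans _ _ (profile_likelihood B0)); last first.
  rewrite ler_wpM2l//.
  rewrite le_eqVlt; apply/predU1P; left; apply: eq_bigr => i _.
  have ti0 := row_scatter_gt0 yspan i (unit_neq0 _ uB0).
  rewrite Gamma0E; congr (_ * expR (- _)).
  by rewrite invf_div mulrCA divff ?mulr1// gt_eqF.
rewrite !profile_likelihoodE ler_wpM2l//.
  apply: mulr_ge0; first by rewrite invr_ge0 exprn_ge0// ltW.
  by apply: exprn_ge0; rewrite mulr_ge0 ?expR_ge0// exprn_ge0// ltW.
by rewrite ler_pXn2r ?nnegrE//; exact: B0max.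
Qed.

End mle.

(** * Measurability of entries and determinants *)

Lemma measurable_entry (R : realType) p q i j :
  measurable_fun setT (fun M : borel_matrix R p q => M i j).
Proof.
apply: (measurability _ (RGenOpens.measurableE R)) => //.
move=> _ [_ [a [b ->]] <-]; rewrite setTI; apply: sub_sigma_algebra.
have /continuousP := @coord_continuous R p q i j; apply; exact: interval_open.
Qed.

Lemma measurable_det d (T : measurableType d) (R : realType) n
    (A : T -> 'M[R]_n) :
  (forall i j, measurable_fun setT (fun x => A x i j)) ->
  measurable_fun setT (fun x => \det (A x)).
Proof.
move=> mA; apply: measurable_sum => s; apply: measurable_funM => //.
by apply: measurable_prod => i _; exact: mA.
Qed.

(** * Independence and null sections *)

Section independence.
Variables (R : realType) (d d' : measure_display).
Variables (T : measurableType d) (T' : measurableType d') (P : probability T R).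

(** Fubini: by independence the pair of the identity, taken onto the sigma-algebra generated by [G],
    and [V] has a product law, so the probability is the integral of those of the sections. *)
Lemma indep_section_null (G : set (set T)) (V : {RV P >-> T'}) :
    G `<=` measurable ->
    (forall A B, <<s G >> A -> measurable B ->
      P (A `&` V @^-1` B) = (P A * P (V @^-1` B))%E) ->
  forall E : set (g_sigma_algebraType G * T'), measurable E ->
    (forall w, P (V @^-1` xsection E w) = 0%E) ->
  P [set w | E (w, V w)] = 0%E.
Proof.
move=> Gm indep E mE E0.
have mid : measurable_fun setT (id : T -> g_sigma_algebraType G).
  move=> _ A sA; rewrite setTI preimage_id; move: A sA; apply: smallest_sub => //.
  exact: sigma_algebra_measurable.
pose h1 : {mfun T >-> g_sigma_algebraType G} :=
  HB.pack (id : T -> g_sigma_algebraType G) (isMeasurableFun.Build _ _ _ _ _ mid).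
have mpair : measurable_fun setT (fun w : T => ((w : g_sigma_algebraType G), V w)).
  by apply: measurable_fun_pair => //; exact: measurable_funP.
pose h2 : {mfun T >-> (g_sigma_algebraType G * T')%type} :=
  HB.pack (fun w : T => ((w : g_sigma_algebraType G), V w))
    (isMeasurableFun.Build _ _ _ _ _ mpair).
have prodE := product_measure_unique (m1 := distribution P h1)
  (m2 := distribution P V) (m' := distribution P h2).
transitivity (distribution P h2 E) => //.
by rewrite -prodE// /product_measure1; apply: integral0_eq => w _ /=; exact: E0.
Qed.

Variables (I : finType) (X : I -> {RV P >-> T'}).

(** A family closed under intersections that generates the sigma-algebra of the [X i] with
    [i \in J]. *)
Definition cylinders (J : {set I}) : set (set T) :=
  [set A | exists2 B : I -> set T', (forall i, measurable (B i)) &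
     A = \bigcap_(i in [set i | i \in J]) (X i @^-1` B i)].

Lemma cylinders_measurable (J : {set I}) : cylinders J `<=` measurable.
Proof.
move=> _ [B mB ->]; apply: fin_bigcap_measurable; first exact: finite_finset.
by move=> i _; rewrite -[X in measurable X]setTI; exact: measurable_funP.
Qed.

Lemma measurable_cylinders (J : {set I}) i :
  i \in J -> measurable_fun setT (X i : g_sigma_algebraType (cylinders J) -> T').
Proof.
move=> iJ _ B mB; rewrite setTI; apply: sub_sigma_algebra.
exists (fun j => if j == i then B else setT).
  by move=> j; case: ifP.
apply/seteqP; split => [w Bw j _|w /(_ i iJ)]; last by rewrite /= eqxx.
by rewrite /preimage/=; case: eqP => // ->.
Qed.

(** For fixed [B] both sides are finite measures in [A]. They agree on the cylinders by mutual
    independence, hence on the generated sigma-algebra. *)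
Lemma indep_cylinders (J : {set I}) k A B : mutually_independent X -> k \notin J ->
    <<s cylinders J >> A -> measurable B ->
  P (A `&` X k @^-1` B) = (P A * P (X k @^-1` B))%E.
Proof.
move=> Xind kJ sA mB.
have mXB : measurable (X k @^-1` B).
  by rewrite -[X in measurable X]setTI; exact: measurable_funP.
have PB_fin : P (X k @^-1` B) \is a fin_num by exact: fin_num_measure.
pose r : {nonneg R} := NngNum (fine_ge0 (measure_ge0 P (X k @^-1` B))).
have rE : (r%:num)%:E = P (X k @^-1` B) by rewrite fineK.
rewrite muleC -rE -/(mscale r P A).
have traceE : [set Y | cylinders J Y /\ Y `<=` setT] = cylinders J.
  by apply/seteqP; split => [Y []|Y].
have := @g_sigma_algebra_measure_unique_trace d R T (cylinders J) setT measurableT.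
rewrite traceE => /(_ _ _ (mrestr P mXB) (mscale r P)); apply => //.
- exact: cylinders_measurable.
- move=> _ _ [B1 mB1 ->] [B2 mB2 ->]; exists (fun i => B1 i `&` B2 i).
    by move=> i; exact: measurableI.
  by rewrite bigcapI.
- by rewrite /= /mrestr /mscale/= setTI probability_setT mule1 rE.
- move=> _ [C mC ->]; rewrite /= /mrestr /mscale rE.
  (* Adding the constraint [B] at index [k] turns the intersection into a cylinder over [k |: J]. *)
  pose C' i := if i == k then B else C i.
  have mC' i : measurable (C' i) by rewrite /C'; case: ifP.
  have C'J i : i \in J -> C' i = C i.
    by move=> iJ; rewrite /C'; case: eqP => // ik; rewrite -ik iJ in kJ.
  have C'k : C' k = B by rewrite /C' eqxx.
  have := Xind (k |: J)%SET C' mC'; rewrite big_setU1//= C'k.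
  under eq_bigr => i iJ do rewrite C'J//.
  rewrite -(Xind J C mC) => <-; congr (P _).
  apply/seteqP; split => [w [wC wB] i /=|w wC'].
    by rewrite in_setU1 => /predU1P[->|iJ]; rewrite ?C'k// C'J//; exact: wC.
  split=> [i iJ|]; first by rewrite -C'J//; apply: wC'; rewrite /= in_setU1 iJ orbT.
  by have := wC' k; rewrite /= setU11 C'k; exact.
- by rewrite /= /mrestr setTI (le_lt_trans (probability_le1 _ _))// ltry.
Qed.

End independence.

(** * Gaussian measure of points and hyperplanes *)

Lemma normal_law_set1 (R : realType) (m v c : R) :
  v != 0 -> normal_law m v [set c] = 0%E.
Proof.
move=> v0; rewrite /normal_law (negbTE v0).
have /null_content_dominatesP := @normal_prob_dominates R m (Num.sqrt v).
by apply => //; exact: lebesgue_measure_set1.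
Qed.

(** The linear form with coefficients [u *t e], [e] being the i-th basis vector, sends [vec (Y w)]
    to [row i (Y w) *m u]; its variance, u^T Psi u times [Gamma i i], is positive, so its law has no
    atoms. *)
Lemma hyperplane_null (R : realType) d (T : measurableType d)
    (P : probability T R) p q (Y : T -> 'M[R]_(p, q)) mu
    (Gamma : 'M[R]_p) (Psi : 'M[R]_q) (i : 'I_p) (u : 'cV[R]_q) (c : R) :
    diagonal_pos Gamma -> symmetric_posdef Psi ->
    multivariate_normal P (fun w => vec (Y w)) mu (Psi *t Gamma) ->
    u != 0 ->
  P [set w | (row i (Y w) *m u) 0 0 = c] = 0%E.
Proof.
move=> [_ Gpos] [_ Ppos] YN u0.
pose e : 'cV[R]_p := delta_mx i 0.
pose a : 'cV[R]_(q * p) := u *t e.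
have entry00 (A B : 'M[R]_1) : (A *t B : 'M[R]_1) 0 0 = A 0 0 * B 0 0.
  by rewrite -tensmxE; congr (fun_of_matrix _ _ _); exact: val_inj.
have aY w : (a^T *m vec (Y w)) 0 0 = (row i (Y w) *m u) 0 0.
  have -> : vec (Y w) = \sum_j ((delta_mx j 0 : 'cV[R]_q) *t col j (Y w)).
    apply/matrixP => k l; rewrite summxE mxE (bigD1 (mxtens_unindex k).1)//=.
    rewrite big1 ?addr0 => [|j jk]; rewrite !mxE.
      by rewrite (ord1 (@mxtens_unindex 1 1 l).1) !eqxx mul1r.
    by rewrite eq_sym (negbTE jk) mul0r.
  rewrite mulmx_sumr summxE [RHS]mxE; apply: eq_bigr => j _.
  transitivity
    (((u^T *m (delta_mx j 0 : 'cV_q)) *t (e^T *m col j (Y w)) : 'M[R]_1) 0 0).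
    by rewrite -tensmx_mul -trmx_tens.
  by rewrite entry00 /e trmx_delta -colE -rowE !mxE mulrC.
have aS : (a^T *m (Psi *t Gamma) *m a) 0 0 = (u^T *m Psi *m u) 0 0 * Gamma i i.
  transitivity (((u^T *m Psi *m u) *t (e^T *m Gamma *m e) : 'M[R]_1) 0 0).
    by rewrite -!tensmx_mul -trmx_tens.
  by rewrite entry00 /e trmx_delta -rowE -colE !mxE.
have := YN a [set c] (measurable_set1 c).
rewrite normal_law_set1; last by rewrite aS gt_eqF// mulr_gt0// Ppos.
by move=> <-; congr (P _); apply/seteqP; split => w /=; rewrite aY.
Qed.

(** * Almost sure nonvanishing of the leading minors *)

Section affine_independence.
Variables (R : realType) (d : measure_display) (T : measurableType d).
Variables (P : probability T R) (p q n : nat).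
Variables (X : 'I_n -> {RV P >-> borel_matrix R p q}) (i : 'I_p).
Hypothesis X_indep : mutually_independent X.
Hypothesis X_null : forall k (u : 'cV[R]_q) c, u != 0 ->
  P [set w | (row i (X k w) *m u) 0 0 = c] = 0%E.

(** Entry [b] of the row (1, x_ki). A natural number index serves minors of all sizes; values above
    q fall back to entry 0 and do not occur in [augmented_minor m] for m <= q. *)
Definition augmented_row (v : 'M[R]_(p, q)) (b : nat) : R :=
  (row_mx 1%:M (row i v) : 'rV_(1 + q)) 0 (@inord q b).

Lemma augmented_row0 v : augmented_row v 0 = 1.
Proof.
rewrite /augmented_row (_ : @inord q 0 = lshift q (ord0 : 'I_1)) ?row_mxEl ?mxE//.
by apply/val_inj; rewrite /= inordK.
Qed.

Lemma augmented_rowS v (b : 'I_q) : augmented_row v b.+1 = v i b.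
Proof.
rewrite /augmented_row (_ : @inord q b.+1 = @rshift 1 q b) ?row_mxEr ?mxE//.
by apply/val_inj; rewrite /= inordK// ltnS.
Qed.

Lemma measurable_augmented_row b :
  measurable_fun setT (augmented_row ^~ b : borel_matrix R p q -> R).
Proof.
rewrite /augmented_row; case: (split_ordP (@inord q b : 'I_(1 + q))) => j ->.
  by under eq_fun do rewrite row_mxEl; exact: measurable_cst.
by under eq_fun do rewrite row_mxEr mxE; exact: measurable_entry.
Qed.

Definition augmented_minor m (x : nat -> 'M[R]_(p, q)) : 'M[R]_m.+1 :=
  \matrix_(a, b) augmented_row (x a) b.

Variable k0 : 'I_n.
Let ix (a : nat) : 'I_n := insubd k0 a.

(** The cofactors of the last row do not involve [v]: that of the column of ones is [c], the others
    are the coordinates of [u], completed by zeros. *)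
Lemma augmented_minor_expand m (x : nat -> 'M[R]_(p, q)) : (m < q)%N ->
    \det (augmented_minor m x) != 0 ->
  exists (u : 'cV[R]_q) c, u != 0 /\ forall v,
    \det (augmented_minor m.+1 (fun a => if (a <= m)%N then x a else v)) =
    (row i v *m u) 0 0 + c.
Proof.
move=> mq x0.
pose N v := augmented_minor m.+1 (fun a => if (a <= m)%N then x a else v).
have bump_ord (a : 'I_m.+1) : bump m.+1 a = a by rewrite /bump leqNgt ltn_ord.
have cofE v b : cofactor (N v) ord_max b = cofactor (N 0) ord_max b.
  rewrite /cofactor; congr (_ * \det _); apply/matrixP => a b'; rewrite !mxE /=.
  by rewrite bump_ord -ltnS ltn_ord.
pose c b := cofactor (N 0) ord_max b.
pose widen (b : 'I_m.+1) : 'I_q := widen_ord mq b.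
exists (\sum_(b < m.+1) c (lift ord0 b) *: delta_mx (widen b) 0), (c ord0).
split; last first.
  move=> v; rewrite (expand_det_row _ ord_max) big_ord_recl cofE addrC.
  have NmaxE b : N v ord_max b = augmented_row v b by rewrite mxE /= ltnn.
  rewrite NmaxE augmented_row0 mul1r; congr (_ + _).
  rewrite mulmx_sumr summxE; apply: eq_bigr => b _.
  rewrite cofE NmaxE -scalemxAr -colE !mxE lift0 -/(c _) mulrC; congr (_ * _).
  exact: (augmented_rowS v (widen b)).
(* Coordinate m of [u] is the corner cofactor, which is the previous minor up to sign. *)
apply: contraNneq x0 => /matrixP/(_ (widen ord_max) 0).
rewrite summxE (bigD1 ord_max)//= big1 => [|b bmax]; last first.
  rewrite !mxE eqxx andbT (_ : (_ == _) = false) ?mulr0//.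
  by apply/negbTE; rewrite eq_sym; apply: contra bmax => /eqP[] /eqP.
rewrite addr0 !mxE !eqxx mulr1 /c (_ : lift ord0 ord_max = ord_max); last exact/val_inj.
rewrite /cofactor => /eqP; rewrite mulf_eq0 signr_eq0 /= => /eqP N0.
apply/eqP; rewrite -[RHS]N0; congr (\det _); apply/matrixP => a b; rewrite !mxE /=.
by rewrite !bump_ord -ltnS ltn_ord.
Qed.

Let null_minor m : set T :=
  [set w | \det (augmented_minor m (fun a => X (ix a) w)) = 0].

Let measurable_null_minor m : measurable (null_minor m).
Proof.
have mdet : measurable_fun setT
    (fun w => \det (augmented_minor m (fun a => X (ix a) w))).
  apply: measurable_det => a b; under eq_fun do rewrite mxE.
  by apply: (measurableT_comp (measurable_augmented_row b)); exact: measurable_funP.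
by have := mdet measurableT _ (measurable_set1 0); rewrite setTI.
Qed.

(** Induction from the constant minor 1. Where the next minor vanishes and the previous one does
    not, the new observation lies in a hyperplane determined by the earlier ones. *)
Lemma augmented_minor_null m : (m <= q)%N -> (m < n)%N ->
  P [set w | \det (augmented_minor m (fun a => X (ix a) w)) = 0] = 0%E.
Proof.
elim: m => [_ _|m IHm mq mn].
  rewrite (_ : [set _ | _] = set0) ?measure0//; apply/seteqP; split => // w /=.
  by rewrite det_mx11 mxE augmented_row0 => /eqP; rewrite oner_eq0.
have ixE a : (a < n)%N -> ix a = a :> nat by move=> an; rewrite val_insubd an.
pose J : {set 'I_n} := [set k : 'I_n | (k <= m)%N]%SET.
have ixJ a : (a <= m)%N -> ix a \in J.
  by move=> am; rewrite inE ixE// (leq_ltn_trans am)// ltnW.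
have kJ : ix m.+1 \notin J by rewrite inE ixE// ltnn.
pose G := cylinders X J.
(* The new observation becomes a free variable [v]; the earlier ones are measurable for the
   sigma-algebra generated by [G]. *)
pose N (w : g_sigma_algebraType G) (v : borel_matrix R p q) :=
  augmented_minor m.+1 (fun a => if (a <= m)%N then X (ix a) w else v).
pose M (w : g_sigma_algebraType G) := augmented_minor m (fun a => X (ix a) w).
have mX a b : (a <= m)%N -> measurable_fun setT
    (fun w : g_sigma_algebraType G => augmented_row (X (ix a) w) b).
  move=> am; apply: (measurableT_comp (measurable_augmented_row b)).
  exact: measurable_cylinders (ixJ _ am).
have mM : measurable_fun setT (fun w => \det (M w)).
  apply: measurable_det => a b; under eq_fun do rewrite mxE.
  by apply: mX; rewrite -ltnS.
have mN : measurable_fun setT (fun wv => \det (N wv.1 wv.2)).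
  apply: measurable_det => a b; under eq_fun do rewrite mxE.
  case: (boolP (a <= m)%N) => am; first exact: measurableT_comp (mX _ _ am) measurable_fst.
  exact: measurableT_comp (measurable_augmented_row b) measurable_snd.
(* Discarding the [w] where the previous minor is zero makes every section empty or an affine
   hyperplane. *)
pose E : set (g_sigma_algebraType G * borel_matrix R p q) :=
  [set wv | \det (N wv.1 wv.2) = 0 /\ \det (M wv.1) != 0].
have mE : measurable E.
  rewrite (_ : E = [set wv | \det (N wv.1 wv.2) = 0] `\`
                   ((fun wv => \det (M wv.1)) @^-1` [set 0])); last first.
    by apply/seteqP; split => wv [N0 /eqP M0].
  apply: measurableD; first by have := mN measurableT _ (measurable_set1 0); rewrite setTI.
  have mM1 : measurable_fun setT
      (fun wv : g_sigma_algebraType G * borel_matrix R p q => \det (M wv.1)).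
    exact: measurableT_comp mM measurable_fst.
  by have := mM1 measurableT _ (measurable_set1 0); rewrite setTI.
have E0 w : P (X (ix m.+1) @^-1` xsection E w) = 0%E.
  have [Mw0|Mw] := eqVneq (\det (M w)) 0.
    rewrite (_ : _ @^-1` _ = set0) ?measure0//; apply/seteqP; split => // w'.
    by move=> /set_mem[_]; rewrite /= Mw0 eqxx.
  have [u [c [u0 NE]]] := augmented_minor_expand mq Mw.
  have NwE v : \det (N w v) = (row i v *m u) 0 0 + c := NE v.
  rewrite -(X_null (ix m.+1) (- c) u0); congr (P _); apply/seteqP.
  split => w' /= Ew'; [|apply/mem_set; split => //].
    by apply/eqP; rewrite -addr_eq0 -NwE; apply/eqP; case/set_mem: Ew'.
  by rewrite /= NwE Ew' addNr.
have NX w : N w (X (ix m.+1) w) = augmented_minor m.+1 (fun a => X (ix a) w).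
  apply/matrixP => a b; rewrite !mxE; case: leqP => // am.
  by congr (augmented_row (X (ix _) w) _); apply/eqP; rewrite eqn_leq am -ltnS ltn_ord.
have EX : [set w | E (w, X (ix m.+1) w)] = null_minor m.+1 `\` null_minor m.
  apply/seteqP; split => w [N0 M0]; split => //; first by rewrite /null_minor/= -NX.
  - exact/eqP.
  - by rewrite /= NX.
  - exact/eqP.
apply: (measure_negligible (measurable_null_minor m.+1)).
apply: (@negligibleS _ _ _ _ ((null_minor m.+1 `\` null_minor m) `|` null_minor m)).
  by move=> w Nw; have [|] := pselect (null_minor m w); [right|left].
apply: negligibleU; apply/negligibleP => //.
- exact: measurableD.
- rewrite -EX; apply: (indep_section_null (@cylinders_measurable _ _ _ _ _ _ _ X J) _ mE E0).
  by move=> A B; exact: indep_cylinders.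
- by apply: IHm; exact: ltnW.
Qed.

Lemma ae_augmented_minor_neq0 : (q < n)%N ->
  {ae P, forall w, \det (augmented_minor q (fun a => X (ix a) w)) != 0}.
Proof.
move=> qn; exists (null_minor q); split => //.
  exact: augmented_minor_null.
by move=> w /= /negP; rewrite negbK => /eqP.
Qed.

(** The column of ones absorbs the mean: [v], completed by a first coordinate, gives a vector [t] in
    the kernel of an invertible matrix. *)
Lemma rows_span_augmented_minor w :
  \det (augmented_minor q (fun a => X (ix a) w)) != 0 ->
  forall v : 'cV[R]_q,
    (forall k, row i (X k w - sample_mean (X ^~ w)) *m v = 0) -> v = 0.
Proof.
move=> det0 v Xv.
pose t : 'cV[R]_(1 + q) := col_mx (- (row i (sample_mean (X ^~ w)) *m v)) v.
suff : t = 0 by move=> /(congr1 dsubmx); rewrite col_mxKd linear0.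
have uM : augmented_minor q (fun a => X (ix a) w) \in unitmx.
  by rewrite unitmxE unitfE.
apply: (can_inj (mulKmx uM)); rewrite mulmx0.
apply/matrixP => a b; rewrite [RHS]mxE [LHS]mxE.
transitivity ((row_mx 1%:M (row i (X (ix a) w)) *m t) 0 b).
  rewrite [RHS]mxE; apply: eq_bigr => c _; congr (_ * _).
  by rewrite mxE /augmented_row inord_val.
rewrite mul_row_col mul1mx addrC -mulmxBl -linearB /= Xv mxE//.
Qed.

End affine_independence.

Theorem theorem8 (R : realType) (d : measure_display) (T : measurableType d)
    (P : probability T R) (p q n : nat)
    (p_gt0 : (0 < p)%N) (q_gt0 : (0 < q)%N) (n_gt0 : (0 < n)%N)
    (mu : 'cV[R]_(q * p)) (Gamma : 'M[R]_p) (Psi : 'M[R]_q)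
    (Gamma_diag : diagonal_pos Gamma) (Psi_posdef : symmetric_posdef Psi)
    (X : 'I_n -> {RV P >-> borel_matrix R p q})
    (X_indep : mutually_independent X)
    (X_normal : forall k : 'I_n,
       multivariate_normal P (fun w => vec (X k w)) mu (Psi *t Gamma))
    (q_lt_n : (q < n)%N) :
  {ae P, forall w, exists S : 'M[R]_(q * p), is_mle_diag (fun k => X k w) S}.

Proof.
have k0 : 'I_n := Ordinal n_gt0.
have X_null i k (u : 'cV[R]_q) c : u != 0 ->
    P [set w | (row i (X k w) *m u) 0 0 = c] = 0%E.
  exact: hyperplane_null Gamma_diag Psi_posdef (X_normal k).
(* Each row index has its own exceptional null set, and there are finitely many of them. *)
have ae_minor : {ae P, forall w (i : 'I_p),
    \det (augmented_minor i q (fun a => X (insubd k0 a) w)) != 0}.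
  apply: filter_forall => i.
  exact: ae_augmented_minor_neq0 X_indep (X_null i) k0 q_lt_n.
apply: filterS ae_minor => w det0.
apply: mle_diag_exists => // i v Xv.
exact: rows_span_augmented_minor (det0 i) v Xv.
Qed.
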